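(* Let $D\subset\mathbb R^N$ be a domain and $p\ge2$. For $f,g\in L^p(D)$ set \[ w(p,f,g)^2=p(p-1)\int_0^1 s|sg+(1-s)f|^{p-2}ds \] pointwise, and $E(f,g)=\|f\|_{L^p(D)}^p+(p-1)\|g\|_{L^p(D)}^p-p\int_D|g|^{p-2}gf\,dx$. Then $E(f,g)=\|w(p,f,g)(f-g)\|^2_{L^2(D)}$, and moreover: (1) (First type.) Let \[ \lambda_p=\min_{x\in[1/2,1]}\{x^p+(1-x)^{p-1}(x+p-1)\}. \] Then $\lambda_p\in[2^{-p},p\,2^{1-p}]$, $\lambda_2=1$, and for all $f,g\in L^p(D)$, \[ E(f,g)=\|w(p,f,g)(f-g)\|^2_{L^2(D)}\ge\lambda_p\|f-g\|^p_{L^p(D)}. \] (2) (Second type.) For all $f,g\in L^p(D)$, \[ E(f,g)=\|w(p,f,g)(f-g)\|^2_{L^2(D)}\ge\frac p2\int_D|g|^{p-2}(f-g)^2dx. \] *)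

(* Defs.v *)
From HB Require Import structures.
From mathcomp Require Import all_boot all_order all_algebra.
From mathcomp Require Import all_classical all_reals all_analysis.
Set Implicit Arguments. Unset Strict Implicit. Unset Printing Implicit Defensive.
Import Order.TTheory GRing.Theory Num.Theory.
Import numFieldNormedType.Exports.
Local Open Scope classical_set_scope.
Local Open Scope ring_scope.

(* w(p,a,b)^2 = p(p-1) \int_0^1 s |s b + (1-s) a|^(p-2) ds  (pointwise, a = f x, b = g x) *)
Definition wsq (R : realType) (p a b : R) : R :=
  p * (p - 1) *
  Rintegral (@lebesgue_measure R) `[0, 1]
    (fun s : R => s * (`|s * b + (1 - s) * a| `^ (p - 2))).

Definition wfun (R : realType) (p a b : R) : R := Num.sqrt (wsq p a b).

Definition phi_lam (R : realType) (p x : R) : R :=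
  x `^ p + (1 - x) `^ (p - 1) * (x + p - 1).

(* lambda_p = min_{x in [1/2,1]} phi_lam p x (defined as the infimum;
   the main theorem also asserts it is attained) *)
Definition lambda_p (R : realType) (p : R) : R :=
  inf [set phi_lam p x | x in `[2^-1, 1]].

Definition Efun d (T : measurableType d) (R : realType)
  (mu : {measure set T -> \bar R}) (D : set T) (p : R) (f g : T -> R) : \bar R :=
  ((\int[mu]_(x in D) (`|f x| `^ p)%:E)
   + (p - 1)%:E * (\int[mu]_(x in D) (`|g x| `^ p)%:E)
   - p%:E * (\int[mu]_(x in D) (`|g x| `^ (p - 2) * g x * f x)%:E))%E.

(* Main.v *)
Require Import Defs.
From HB Require Import structures.
From mathcomp Require Import all_boot all_order all_algebra.
From mathcomp Require Import all_classical all_reals all_analysis.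
From mathcomp Require Import measurable_realfun ring lra.
Import Order.TTheory GRing.Theory Num.Theory.
Import numFieldNormedType.Exports.
Local Open Scope classical_set_scope.
Local Open Scope ring_scope.

(* Pointwise, with a = f x and b = g x, the quantity
     gap p a b = |a|^p + (p-1) |b|^p - p |b|^(p-2) b a
   is the remainder in Taylor's formula for |.|^p, whose integral form is
   w(p,a,b)^2 (a-b)^2.  The second bound is Bernoulli's inequality for the
   exponent p/2.  For the first one, homogeneity reduces to a - b = 1; then
   gap p t (t-1) equals phi_lam p t on [1/2,1], is at least phi_lam p (1-t) for
   t in [0,1/2], and is at least 1 = phi_lam p 1 outside of [0,1]. *)

(** * Real powers: tangent inequality, continuity, derivative *)

Lemma powRS (R : realType) (x r : R) : 0 <= x -> 0 <= r ->
  x `^ (r + 1) = x `^ r * x.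
Proof.
move=> x0 r0; rewrite mulrC -mulr_powRB1 ?addrK//; lra.
Qed.

Lemma norm_powRD2 (R : realType) (p x : R) : 2 <= p ->
  `|x| `^ p = `|x| `^ (p - 2) * x ^+ 2.
Proof.
move=> p2.
have -> : p = (p - 2) + 1 + 1 by ring.
by rewrite !powRS ?real_normK ?num_real//; [rewrite -mulrA -expr2 real_normK ?num_real//; congr (_ `^ _ * _); ring|lra|lra].
Qed.

Lemma powR_tangent_le (R : realType) (q x y : R) : 1 <= q -> 0 <= x -> 0 <= y ->
  x `^ q + q * x `^ (q - 1) * (y - x) <= y `^ q.
Proof.
move=> q1 x0 y0; have [->|qn1] := eqVneq q 1.
  by rewrite !subrr powRr0 !powRr1//; lra.
have {qn1}q1' : 1 < q by rewrite lt_neqAle eq_sym qn1.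
have q0 : 0 < q - 1 by rewrite subr_gt0.
have := @conjugate_powR R y (x `^ (q - 1)) q (q / (q - 1)) y0 (powR_ge0 _ _).
rewrite -powRrM mulrCA divff ?gt_eqF// mulr1 => H.
have {}H : y * x `^ (q - 1) <= y `^ q / q + x `^ q / (q / (q - 1)).
  apply: H; [lra|by rewrite divr_gt0//; lra|].
  by rewrite invf_div -{1}(mul1r q^-1) -mulrDl addrC subrK divff// gt_eqF//; lra.
have e : x `^ q = x `^ (q - 1) * x by rewrite mulrC mulr_powRB1//; lra.
have {H} : q * (y * x `^ (q - 1)) <= q * (y `^ q / q + x `^ q / (q / (q - 1))).
  by rewrite ler_pM2l//; lra.
have -> : q * (y `^ q / q + x `^ q / (q / (q - 1))) = y `^ q + (q - 1) * x `^ q.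
  by field; rewrite !gt_eqF//; lra.
by rewrite e; nra.
Qed.

Lemma norm_powR_continuous (R : realType) (r : R) : 0 <= r ->
  continuous (fun x : R => `|x| `^ r).
Proof.
move=> r0 x; have [->|rn0] := eqVneq r 0.
  by under eq_fun do rewrite powRr0; exact: cvg_cst.
have {}r0 : 0 < r by rewrite lt_neqAle eq_sym rn0.
have [->|xn0] := eqVneq x 0.
  apply/cvgrPdist_lt => e e0; near=> h.
  rewrite normr0 powR0// sub0r normrN ger0_norm ?powR_ge0//.
  (* By monotonicity of the power, |h| < e^(1/r) suffices. *)
  have -> : e = (e `^ r^-1) `^ r by rewrite -powRrM mulVf// powRr1// ltW.
  apply: gt0_ltr_powR; rewrite ?nnegrE ?normr_ge0 ?powR_ge0//.
  near: h; exact: (@nbhs0_lt R R _ (powR_gt0 _ e0)).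
apply: (@continuous_comp _ _ _ (fun x : R => `|x|) (fun x => x `^ r)).
  exact: norm_continuous.
apply: differentiable_continuous; apply/derivable1_diffP.
by apply: derivable_powR; rewrite in_itv/= andbT normr_gt0.
Unshelve. all: by end_near. Qed.

(** At 0 the difference quotient is |h|^r itself, so continuity of that power gives the limit.
    Elsewhere |t| = sg(x) t near x, and the product and chain rules apply. *)
Lemma is_derive_norm_powR_mul (R : realType) (r x : R) : 0 <= r ->
  is_derive x 1 (fun t : R => `|t| `^ r * t) ((r + 1) * `|x| `^ r).
Proof.
move=> r0; have [->|xn0] := eqVneq x 0.
  have -> : (r + 1) * `|0 : R| `^ r = `|0 : R| `^ r.
    have [->|rn0] := eqVneq r 0; first by rewrite add0r mul1r.
    by rewrite normr0 powR0// mulr0.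
  have H : (fun h : R => h^-1 *: (((fun t : R => `|t| `^ r * t) \o shift (0 : R))
      (h *: (1 : R)) - `|0 : R| `^ r * 0)) @ (0 : R)^' --> `|0 : R| `^ r.
    have : (fun h : R => `|h| `^ r) @ (0 : R)^' --> `|0 : R| `^ r.
      by apply: cvg_within_filter; exact: norm_powR_continuous.
    apply: cvg_trans; apply: near_eq_cvg; near=> h.
    rewrite /= addr0 mulr0 subr0 /GRing.scale/= mulr1 mulrCA mulVf ?mulr1//.
    by near: h; exact: nbhs_dnbhs_neq.
  apply: DeriveDef; first by apply/cvg_ex; eexists; exact: H.
  exact: cvg_lim H.
have sgx : 0 < Num.sg x * x by rewrite -normrEsg normr_gt0.
apply: (@near_eq_is_derive _ _ _ (fun t : R => (Num.sg x * t) `^ r * t)).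
  have : \forall t \near x, 0 < Num.sg x * t.
    have : (fun t : R => Num.sg x * t) @ x --> Num.sg x * x.
      by apply: cvgM; [exact: cvg_cst|exact: cvg_id].
    by move/cvgr_gt; apply.
  apply: filterS => t t0; congr (_ `^ _ * _).
  by rewrite -(gtr0_norm t0) normrM normr_sg xn0 mul1r.
have -> : `|x| = Num.sg x * x by exact: normrEsg.
have H : is_derive x 1 (fun t : R => (Num.sg x * t) `^ r)
    (r * (Num.sg x * x) `^ (r - 1) * Num.sg x).
  apply: (@is_derive1_comp _ (fun t => t `^ r) (fun t => Num.sg x * t)).
    exact: is_derive1_powR.
  by apply: is_derive_eq; rewrite /GRing.scale/= mulr1.
apply: is_derive_eq.
rewrite /GRing.scale/= mulr1.
have -> : (Num.sg x * x) `^ r = (Num.sg x * x) `^ (r - 1) * (Num.sg x * x).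
  rewrite -[X in _ = _ * X](powRr1 (ltW sgx)) -powRD ?subrK//.
  by rewrite (gt_eqF sgx) implybT.
ring.
Unshelve. all: by end_near. Qed.

(** * The pointwise remainder: integral form and second bound *)

Definition gap {R : realType} (p a b : R) : R :=
  `|a| `^ p + (p - 1) * `|b| `^ p - p * (`|b| `^ (p - 2) * b * a).

Lemma wsq_mul_sqr (R : realType) (p a b : R) : 2 <= p ->
  wsq p a b * (a - b) ^+ 2 = gap p a b.
Proof.
rewrite /gap => p2; have r0 : 0 <= p - 2 by rewrite subr_ge0.
(* The antiderivative used below divides by (b - a)^2; for a = b both sides vanish. *)
have [->|ab] := eqVneq a b.
  by rewrite subrr expr0n mulr0 (norm_powRD2 _ _ _ p2); ring.
have pn0 : p != 0 by rewrite gt_eqF//; lra.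
have pn1 : p - 1 != 0 by rewrite gt_eqF//; lra.
pose c := b - a; have c0 : c != 0 by rewrite subr_eq0 eq_sym.
pose y (s : R) := s * b + (1 - s) * a.
pose K := p * (p - 1) * c ^+ 2.
have K0 : K != 0.
  by rewrite !mulf_neq0 ?expf_neq0.
pose h (t : R) := `|t| `^ (p - 2) * t.
(* An antiderivative of [s * |y s| ^ (p - 2)], found by integrating by parts. *)
pose G (s : R) := (p * c * s - y s) * h (y s) / K.
have dy (s : R) : is_derive s 1 y c.
  rewrite /y; apply: is_derive_eq.
  by rewrite /GRing.scale/= /c; ring.
have dG (s : R) : is_derive s 1 G (s * `|y s| `^ (p - 2)).
  have dh : is_derive s 1 (h \o y) ((p - 2 + 1) * `|y s| `^ (p - 2) * c).
    by apply: is_derive1_comp; exact: is_derive_norm_powR_mul.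
  have -> : G = ((fun t => (p * c * t - y t)) * (h \o y)) * cst (K^-1) by [].
  apply: is_derive_eq.
  (* Since [h (y s)] is |y s|^(p-2) y s, the terms in y s cancel and K s |y s|^(p-2) / K remains. *)
  rewrite /GRing.scale/= /h /cst.
  by rewrite /K; field; rewrite c0 pn1 pn0.
have cG : continuous G.
  by move=> s; apply: differentiable_continuous; apply/derivable1_diffP; case: (dG s).
have FTC : (\int[lebesgue_measure]_(s in `[0, 1]) (s * `|y s| `^ (p - 2)))%R
    = G 1 - G 0.
  rewrite /Rintegral (@continuous_FTC2 _ _ G)//.
  - apply: continuous_subspaceT => s; apply: cvgM; first exact: cvg_id.
    apply: (@continuous_comp _ _ _ y (fun x => `|x| `^ (p - 2))).
      by apply: differentiable_continuous; apply/derivable1_diffP; case: (dy s).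
    exact: norm_powR_continuous.
  - split.
    + by move=> s _; case: (dG s).
    + exact/cvg_at_right_filter/cG.
    + exact/cvg_at_left_filter/cG.
  - by move=> s _; rewrite derive1E; case: (dG s).
rewrite /wsq -[Rintegral _ _ _]/(\int[lebesgue_measure]_(s in `[0, 1]) (s * `|y s| `^ (p - 2)))%R FTC.
rewrite !(norm_powRD2 _ _ _ p2) /G /h /y.
rewrite !(mul0r, mul1r, subrr, subr0, addr0, add0r, mulr1, mulr0) sqrrB.
have := c0; rewrite /K /c => c0'.
by field; rewrite c0' pn1 pn0.
Qed.

(* With w = a^2 and v = b^2 this is the tangent inequality for w^(p/2) at v. *)
Lemma gap_second_type (R : realType) (p a b : R) : 2 <= p ->
  p / 2 * (`|b| `^ (p - 2) * (a - b) ^+ 2) <= gap p a b.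
Proof.
move=> p2; have := @powR_tangent_le R (p / 2) (b ^+ 2) (a ^+ 2).
have sqrp (x r : R) : (x ^+ 2) `^ r = `|x| `^ (2 * r).
  by rewrite powRrM powR_mulrn// real_normK// num_real.
rewrite !sqrp !sqr_ge0 => /(_ _ isT isT).
have -> : 2 * (p / 2) = p by field.
have -> : 2 * (p / 2 - 1) = p - 2 by field.
move=> H; have {}H := H ltac:(lra).
rewrite /gap; move: H; rewrite !(norm_powRD2 _ _ b p2); lra.
Qed.

(** * Lower bounds for the gap when a - b = 1 *)

(** The mixed term scales by |k|^(p-2) k^2 = |k|^p, so k may have either sign: k = -1 reflects, k =
    a - b normalises. *)
Lemma gapZ (R : realType) (p k a b : R) : 2 <= p ->
  gap p (k * a) (k * b) = `|k| `^ p * gap p a b.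
Proof.
move=> p2; rewrite /gap !normrM !powRM// (norm_powRD2 _ _ k p2); ring.
Qed.

(** With X = (b + 1)^(p-1) the gap is b X + X - b^p - p b^(p-1). Bound b X by b times the tangent
    inequality [T], and X by the superadditivity [S]. *)
Lemma gap_addl_ge1 (R : realType) (p b : R) : 2 <= p -> 0 <= b ->
  1 <= gap p (b + 1) b.
Proof.
move=> p2 b0; rewrite /gap (ger0_norm b0) ger0_norm; last by lra.
have b1 : 0 <= b + 1 by lra.
have T := @powR_tangent_le R (p - 1) b (b + 1) ltac:(lra) b0 b1.
have S : b `^ (p - 1) + 1 <= (b + 1) `^ (p - 1).
  have -> : p - 1 = p - 2 + 1 by ring.
  rewrite !powRS//; [|lra|lra].
  have := @ge0_ler_powR R (p - 2) ltac:(lra) b (b + 1); rewrite !nnegrE.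
  move=> /(_ b0 b1 ltac:(lra)).
  have := @ge0_ler_powR R (p - 2) ltac:(lra) 1 (b + 1); rewrite !nnegrE.
  rewrite powR1 => /(_ ltac:(lra) b1 ltac:(lra)).
  have := powR_ge0 b (p - 2); nra.
have e1 : (b + 1) `^ p = (b + 1) * (b + 1) `^ (p - 1).
  by rewrite mulr_powRB1//; lra.
have e2 : b `^ p = b * b `^ (p - 1) by rewrite mulr_powRB1//; lra.
have e3 : b `^ (p - 1) = b * b `^ (p - 2).
  have -> : p - 2 = p - 1 - 1 by ring.
  by rewrite mulr_powRB1//; lra.
rewrite (_ : p - 1 - 1 = p - 2) in T; last by ring.
rewrite e1 e2; move: T S; rewrite e3; nra.
Qed.

(** The tangent at 1 + e for exponent p - 1, evaluated at e and multiplied by e, bounds e^p below;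
    what remains of the gap is exactly (p - 1) (1 + e)^(p-2). *)
Lemma gap_addr_ge1 (R : realType) (p e : R) : 2 <= p -> 0 <= e ->
  1 <= gap p e (1 + e).
Proof.
move=> p2 e0; have e1 : 0 <= 1 + e by lra.
rewrite /gap (ger0_norm e0) (ger0_norm e1).
have := @powR_tangent_le R (p - 1) (1 + e) e ltac:(lra) e1 e0.
have -> : p - 1 - 1 = p - 2 by ring.
have U : 1 <= (1 + e) `^ (p - 2).
  have := @ler_powR R (1 + e) ltac:(lra) 0 (p - 2); rewrite powRr0; apply; lra.
have E1 : (1 + e) `^ (p - 1) = (1 + e) * (1 + e) `^ (p - 2).
  have -> : p - 2 = p - 1 - 1 by ring.
  by rewrite mulr_powRB1//; lra.
have E2 : (1 + e) `^ p = (1 + e) * (1 + e) `^ (p - 1).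
  by rewrite mulr_powRB1//; lra.
have E3 : e `^ p = e * e `^ (p - 1) by rewrite mulr_powRB1//; lra.
rewrite E2 E3 E1 => T; have {}T := ler_wpM2l e0 T.
move: U T; set u := (1 + e) `^ _; set v := e `^ _ => U T.
suff : 1 <= (p - 1) * u by nra.
by nra.
Qed.

Lemma gap_phi_lam (R : realType) (p x : R) : 2 <= p -> x <= 1 -> 0 <= x ->
  gap p x (x - 1) = phi_lam p x.
Proof.
move=> p2 x1 x0; rewrite /gap /phi_lam ger0_norm// ler0_norm ?subr_le0// opprB.
have -> : (1 - x) `^ p = (1 - x) * (1 - x) `^ (p - 1).
  by rewrite mulr_powRB1//; lra.
have -> : (1 - x) `^ (p - 1) = (1 - x) * (1 - x) `^ (p - 2).
  have -> : p - 2 = p - 1 - 1 by ring.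
  by rewrite mulr_powRB1//; lra.
ring.
Qed.

Lemma phi_lam_reflect_le (R : realType) (p x : R) : 2 <= p ->
  0 <= x <= 2^-1 -> phi_lam p (1 - x) <= phi_lam p x.
Proof.
move=> p2 /andP[x0 x1]; rewrite /phi_lam subKr.
have m (r : R) : 0 <= r -> x `^ r <= (1 - x) `^ r.
  by move=> r0; apply: ge0_ler_powR; rewrite ?nnegrE//; lra.
have e (y : R) : 0 <= y -> y `^ p = y ^+ 2 * y `^ (p - 2)
    /\ y `^ (p - 1) = y * y `^ (p - 2).
  move=> y0; have E : y `^ (p - 1) = y * y `^ (p - 2).
    have -> : p - 2 = p - 1 - 1 by ring.
    by rewrite mulr_powRB1//; lra.
  by rewrite expr2 -mulrA -E mulr_powRB1//; lra.
have [e1 e2] := e x x0.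
have [e3 e4] := e (1 - x) ltac:(lra).
have := m p ltac:(lra); have := m (p - 2) ltac:(lra).
rewrite e1 e2 e3 e4.
(* The difference of the two sides is
   (p - 2) ((1 - x)^p - x^p) + p x (1 - x) ((1 - x)^(p-2) - x^(p-2)). *)
set u := x `^ _; set v := (1 - x) `^ _ => uv uv'.
have : 0 <= (p - 2) * ((1 - x) ^+ 2 * v - x ^+ 2 * u).
  by rewrite mulr_ge0//; lra.
have : 0 <= p * (x * (1 - x)) * (v - u).
  by rewrite !mulr_ge0//; lra.
lra.
Qed.

Lemma phi_lam_le_gap (R : realType) (p t : R) : 2 <= p ->
  exists2 x : R, x \in `[2^-1, 1] & phi_lam p x <= gap p t (t - 1).
Proof.
move=> p2; have phi1 : phi_lam p 1 = 1.
  rewrite /phi_lam subrr powR1 powR0 ?gt_eqF//; last by lra.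
  by rewrite mul0r addr0.
have in1 : (1 : R) \in `[2^-1, 1] by rewrite in_itv/=; apply/andP; lra.
have [t0|t0] := leP t 0.
  exists 1 => //; rewrite phi1.
  (* Scaling by -1 makes both arguments nonnegative. *)
  have -> : gap p t (t - 1) = gap p (- t) (1 + - t).
    have := gapZ _ _ (- 1) (- t) (1 + - t) p2.
    rewrite normrN1 powR1 mul1r => <-.
    by congr (gap _ _ _); ring.
  by apply: gap_addr_ge1; lra.
have [t1|t1] := leP 1 t.
  exists 1 => //; rewrite phi1 -{1}(subrK 1 t).
  by apply: gap_addl_ge1; lra.
rewrite (gap_phi_lam _ _ _ p2 (ltW t1) (ltW t0)).
have [th|th] := leP (2^-1) t.
  by exists t => //; rewrite in_itv/= th ltW.
exists (1 - t); first by rewrite in_itv/=; apply/andP; lra.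
by apply: phi_lam_reflect_le => //; apply/andP; lra.
Qed.

(** * The constant lambda_p, and the first bound *)

(** The term x^p is at least (1/2)^p and the other is nonnegative. This also bounds the set of
    values from below, so that its [inf] is a genuine infimum. *)
Lemma phi_lam_ge (R : realType) (p x : R) : 2 <= p -> x \in `[2^-1, 1] ->
  2 `^ (- p) <= phi_lam p x.
Proof.
move=> p2; rewrite in_itv/= => /andP[x1 x2].
have -> : 2 `^ (- p) = (2^-1 : R) `^ p by rewrite -powR_inv1// -powRrM mulN1r.
rewrite /phi_lam -[leLHS]addr0 lerD//; last first.
  by rewrite mulr_ge0 ?powR_ge0//; lra.
by apply: ge0_ler_powR; rewrite ?nnegrE//; lra.
Qed.

Lemma lambda_p_le (R : realType) (p x : R) : 2 <= p -> x \in `[2^-1, 1] ->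
  lambda_p p <= phi_lam p x.
Proof.
move=> p2 xI; apply: ge_inf; last by exists x.
exists (2 `^ (- p)) => _ [y yI <-]; exact: phi_lam_ge.
Qed.

Lemma phi_lam_continuous (R : realType) (p : R) : 2 <= p ->
  {within `[2^-1, 1], continuous (phi_lam p)}.
Proof.
move=> p2.
(* Absolute values make the powers continuous on the whole line and change nothing on [1/2, 1]. *)
have E : {in `[2^-1, 1]%classic,
    (fun x : R => `|x| `^ p + `|1 - x| `^ (p - 1) * (x + p - 1)) =1 phi_lam p}.
  move=> x; rewrite inE/= in_itv/= => /andP[x1 x2].
  by rewrite /phi_lam !ger0_norm//; lra.
apply: (subspace_eq_continuous E); apply: continuous_subspaceT => x.
apply: cvgD; first by apply: norm_powR_continuous; lra.
apply: cvgM.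
  apply: (@continuous_comp _ _ _ (fun x : R => 1 - x) (fun x => `|x| `^ (p - 1))).
    by apply: cvgB; [exact: cvg_cst|exact: cvg_id].
  by apply: norm_powR_continuous; lra.
apply: cvgB; last exact: cvg_cst.
by apply: cvgD; [exact: cvg_id|exact: cvg_cst].
Qed.

Lemma lambda_p_attained (R : realType) (p : R) : 2 <= p ->
  exists2 x : R, x \in `[2^-1, 1] & phi_lam p x = lambda_p p.
Proof.
move=> p2; have le : (2^-1 : R) <= 1 by lra.
have [x xI xmin] := EVT_min le (phi_lam_continuous _ _ p2).
exists x => //; apply/eqP; rewrite eq_le lambda_p_le// andbT.
apply: lb_le_inf; first by exists (phi_lam p x), x.
by move=> _ [y yI <-]; exact: xmin.
Qed.

Lemma lambda_p_bounds (R : realType) (p : R) : 2 <= p ->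
  2 `^ (- p) <= lambda_p p <= p * 2 `^ (1 - p).
Proof.
move=> p2; apply/andP; split.
  by have [x xI <-] := lambda_p_attained _ _ p2; exact: phi_lam_ge.
(* The upper bound is exactly the value of [phi_lam p] at 1/2. *)
have hI : (2^-1 : R) \in `[2^-1, 1] by rewrite in_itv/=; apply/andP; lra.
apply: le_trans (lambda_p_le _ _ _ p2 hI) _; rewrite /phi_lam.
have -> : 1 - 2^-1 = 2^-1 :> R by field.
rewrite -(mulr_powRB1 _ (p := p))//; [|lra..].
have -> : 1 - p = - 1 * (p - 1) by ring.
by rewrite powRrM powR_inv1//; lra.
Qed.

(** On the interval [phi_lam 2] is constant: x^2 + (1 - x)(1 + x) = 1. *)
Lemma lambda_p2 (R : realType) : lambda_p (2 : R) = 1.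
Proof.
have [x + <-] := @lambda_p_attained R 2 (lexx _).
rewrite in_itv/= => /andP[x1 x2]; rewrite /phi_lam.
have -> : 2 - 1 = 1 :> R by ring.
rewrite powRr1 ?powR_mulrn//; [ring|lra..].
Qed.

Lemma gap_first_type (R : realType) (p a b : R) : 2 <= p ->
  lambda_p p * `|a - b| `^ p <= gap p a b.
Proof.
move=> p2; have [->|ab] := eqVneq a b.
  rewrite subrr normr0 powR0 ?mulr0; last by rewrite gt_eqF//; lra.
  by rewrite /gap (norm_powRD2 _ _ b p2); lra.
have c0 : a - b != 0 by rewrite subr_eq0.
(* For t = a / (a - b) one has t - 1 = b / (a - b). *)
have [x xI] := phi_lam_le_gap _ p (a / (a - b)) p2.
move=> /(le_trans (lambda_p_le _ _ _ p2 xI)) H.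
have -> : gap p a b
    = `|a - b| `^ p * gap p (a / (a - b)) (a / (a - b) - 1).
  by rewrite -gapZ//; congr (gap _ _ _); field.
by rewrite mulrC ler_wpM2l ?powR_ge0.
Qed.

Lemma gap_ge0 (R : realType) (p a b : R) : 2 <= p -> 0 <= gap p a b.
Proof.
move=> p2; apply: le_trans (gap_second_type _ _ a b p2).
by rewrite mulr_ge0 ?divr_ge0 ?(mulr_ge0 (powR_ge0 _ _) (sqr_ge0 _))//; lra.
Qed.

Lemma wfun_mul_sqr (R : realType) (p a b : R) : 2 <= p ->
  (wfun p a b * (a - b)) ^+ 2 = gap p a b.
Proof.
move=> p2; rewrite exprMn sqr_sqrtr; first exact: wsq_mul_sqr.
(* The square root can be undone only once [wsq] is known to be nonnegative. *)
rewrite /wsq mulr_ge0//; first by rewrite mulr_ge0//; lra.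
apply: Rintegral_ge0 => s /=; rewrite in_itv/= => /andP[s0 _].
by rewrite mulr_ge0 ?powR_ge0.
Qed.

(** * Measurability and integration *)

Lemma measurable_norm_powR (d : measure_display) (T : measurableType d) (R : realType)
  (D : set T) (r : R) (f : T -> R) :
  measurable_fun D f ->
  measurable_fun D (fun x => `|f x| `^ r).
Proof.
move=> mf; apply: (measurableT_comp (measurable_powR r)).
exact: measurableT_comp.
Qed.

Lemma measurable_gap (d : measure_display) (T : measurableType d) (R : realType)
  (D : set T) (p : R) (f g : T -> R) :
  measurable_fun D f -> measurable_fun D g ->
  measurable_fun D (fun x => gap p (f x) (g x)).
Proof.
move=> mf mg; rewrite /gap; apply: measurable_funB.
  apply: measurable_funD; first exact: measurable_norm_powR.
  by apply: measurable_funM => //; exact: measurable_norm_powR.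
apply: measurable_funM => //; apply: measurable_funM => //.
by apply: measurable_funM => //; exact: measurable_norm_powR.
Qed.

Lemma integrable_norm_powR (d : measure_display) (T : measurableType d) (R : realType)
  (mu : {measure set T -> \bar R}) (D : set T) 
  (r : R) (f : T -> R) : measurable D ->
  measurable_fun D f ->
  (\int[mu]_(x in D) (`|f x| `^ r)%:E < +oo)%E ->
  mu.-integrable D (fun x => (`|f x| `^ r)%:E).
Proof.
move=> mD mf foo; apply/integrableP; split.
  by apply/measurable_EFinP; exact: measurable_norm_powR.
by under eq_integral do rewrite gee0_abs ?lee_fin ?powR_ge0//.
Qed.

Lemma Efun_integral_gap (d : measure_display) (T : measurableType d) (R : realType)
  (mu : {measure set T -> \bar R}) (D : set T) 
  (p : R) (f g : T -> R) : measurable D -> 2 <= p ->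
  measurable_fun D f -> measurable_fun D g ->
  (\int[mu]_(x in D) (`|f x| `^ p)%:E < +oo)%E ->
  (\int[mu]_(x in D) (`|g x| `^ p)%:E < +oo)%E ->
  Efun mu D p f g = (\int[mu]_(x in D) (gap p (f x) (g x))%:E)%E.
Proof.
move=> mD p2 mf mg fp gp.
have If := integrable_norm_powR _ _ _ mu D _ _ mD mf fp.
have Ig := integrable_norm_powR _ _ _ mu D _ _ mD mg gp.
have Ig' := integrableZl mD (p - 1) Ig.
have Ifg := integrableD mD If Ig'.
(* Linearity of the integral needs the mixed term integrable. Nonnegativity of the gap at (|f|, |g|)
   bounds p |g|^(p-1) |f| by |f|^p + (p - 1) |g|^p, and p >= 1. *)
have Ic : mu.-integrable D (fun x => (`|g x| `^ (p - 2) * g x * f x)%:E).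
  apply: le_integrable Ifg => //.
    apply/measurable_EFinP; apply: measurable_funM => //.
    by apply: measurable_funM => //; exact: measurable_norm_powR.
  move=> x _; rewrite -EFinM -EFinD !abse_EFin lee_fin.
  have := gap_ge0 _ p `|f x| `|g x| p2; rewrite /gap !normr_id => H.
  apply: le_trans (ler_norm _).
  rewrite !normrM (ger0_norm (powR_ge0 _ _)).
  have : 0 <= `|g x| `^ (p - 2) * `|g x| * `|f x|.
    by rewrite !mulr_ge0 ?powR_ge0.
  by nra.
have Ic' := integrableZl mD p Ic.
rewrite /Efun -(integralZl mD Ig) -(integralZl mD Ic) -(integralD mD If Ig').
by rewrite -(integralB mD Ifg Ic').
Qed.

(** Carries the two pointwise bounds over to integrals, with the gap as [v]. *)
Lemma scaled_integral_le (d : measure_display) (T : measurableType d) (R : realType)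
  (mu : {measure set T -> \bar R}) (D : set T) 
  (k : R) (u v : T -> R) : measurable D -> 0 <= k ->
  measurable_fun D u -> measurable_fun D v -> (forall x, 0 <= u x) ->
  (forall x, k * u x <= v x) ->
  (k%:E * \int[mu]_(x in D) (u x)%:E <= \int[mu]_(x in D) (v x)%:E)%E.
Proof.
move=> mD k0 mu_ mv u0 kuv.
rewrite -ge0_integralZl ?lee_fin//; last 2 first.
- by apply/measurable_EFinP.
- by move=> x _; rewrite lee_fin.
apply: ge0_le_integral => //.
- by move=> x _; rewrite -EFinM lee_fin mulr_ge0.
- apply/measurable_EFinP; exact: measurable_funM.
- by apply/measurable_EFinP.
- by move=> x _; rewrite -EFinM lee_fin.
Qed.

Theorem mainTheorem12 (d : measure_display) (T : measurableType d) (R : realType)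
  (mu : {measure set T -> \bar R}) (D : set T) (mD : measurable D)
  (p : R) (hp : 2 <= p) (f g : T -> R)
  (mf : measurable_fun D f) (mg : measurable_fun D g)
  (fp : (\int[mu]_(x in D) (`|f x| `^ p)%:E < +oo)%E)
  (gp : (\int[mu]_(x in D) (`|g x| `^ p)%:E < +oo)%E) :
  (* E(f,g) = || w(p,f,g) (f-g) ||_{L^2(D)}^2 *)
  Efun mu D p f g
    = (\int[mu]_(x in D) ((wfun p (f x) (g x) * (f x - g x)) ^+ 2)%:E)%E
  (* (1) first type *)
  /\ (exists2 x0 : R, x0 \in `[2^-1, 1] & phi_lam p x0 = lambda_p p)
  /\ 2 `^ (- p) <= lambda_p p <= p * 2 `^ (1 - p)
  /\ lambda_p (2 : R) = 1
  /\ ((lambda_p p)%:E * \int[mu]_(x in D) (`|f x - g x| `^ p)%:E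
        <= Efun mu D p f g)%E
  (* (2) second type *)
  /\ ((p / 2)%:E * \int[mu]_(x in D) (`|g x| `^ (p - 2) * (f x - g x) ^+ 2)%:E
        <= Efun mu D p f g)%E.
Proof.
have mfg : measurable_fun D (fun x => f x - g x) by exact: measurable_funB.
have mgap := measurable_gap _ _ _ D p f g mf mg.
have lp := lambda_p_bounds _ _ hp.
rewrite Efun_integral_gap//; split; last split.
- by apply: eq_integral => x _; rewrite wfun_mul_sqr.
- exact: lambda_p_attained.
split; [exact: lp|split; [exact: lambda_p2|split]].
- apply: scaled_integral_le => //.
  (* The lower bound 2^(-p) makes lambda_p nonnegative. *)
  + by case/andP: lp => lp _; exact: le_trans (powR_ge0 _ _) lp.
  + exact: measurable_norm_powR.
  + by move=> x; exact: gap_first_type.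
- apply: scaled_integral_le => //.
  + by rewrite divr_ge0//; lra.
  + apply: measurable_funM; first exact: measurable_norm_powR.
    exact: measurable_funX.
  + by move=> x; rewrite mulr_ge0 ?powR_ge0 ?sqr_ge0.
  + by move=> x; exact: gap_second_type.
Qed.
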